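(* Let $N$ be a positive integer and let $\phi=(\phi_1,\dots,\phi_N)$ be a nondegenerate critical point of the potential $$V(\theta)=-\sum_{1\le i<j\le N}\left(\cos(\theta_i-\theta_j)+\frac12\log\bigl(2-2\cos(\theta_i-\theta_j)\bigr)\right).$$ Then, for $\rho=(1,1,\dots,1)$, the configuration $(\rho,\phi)$ is a relative equilibrium of the $(1+N)$-vortex problem; that is, there exists a sequence of relative equilibria of the $(N+1)$-vortex problem which converges to $(\rho,\phi)$ as $\varepsilon\to0$.
   Context: For $(x,y)\in\mathbb{R}^2$ write $(x,y)^\perp=(-y,x)$. The $(N+1)$-vortex problem with circulations $\Gamma_0=1$, $\Gamma_1=\dots=\Gamma_N=\varepsilon$ (where $\varepsilon\in\mathbb{R}$ may have either sign) is the system for pairwise distinct $q_0,\dots,q_N\in\mathbb{R}^2$ $$\dot q_j=\sum_{i=0,\,i\ne j}^N \Gamma_i\frac{(q_j-q_i)^\perp}{|q_j-q_i|^2},\qquad j=0,\dots,N.$$ A relative equilibrium of it is a configuration that is a fixed point in the frame rotating rigidly about the origin at rate $\omega=1$, i.e. $q_j^\perp=\sum_{i\ne j}\Gamma_i\frac{(q_j-q_i)^\perp}{|q_j-q_i|^2}$ for all $j$; the center of vorticity is always taken at the origin: $q_0=-\varepsilon(q_1+\dots+q_N)$. Thus a configuration for given $\varepsilon$ is determined by the polar coordinates $(r,\theta)=(r_1,\dots,r_N,\theta_1,\dots,\theta_N)$ of $q_1,\dots,q_N$, and for the limit $\varepsilon=0$ one has $q_0=0$. A relative equilibrium of the $(1+N)$-vortex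 problem is a configuration $(q_0,\dots,q_N)$ for which there are nonzero real numbers $\varepsilon_k\to0$ and, for each $k$, a relative equilibrium $(q_0^k,\dots,q_N^k)$ of the $(N+1)$-vortex problem with $\varepsilon=\varepsilon_k$, such that $q_j^k\to q_j$ for $j=0,\dots,N$; moreover it is required that, for some $m,M>0$ independent of $k$, $|q_i^k-q_j^k|\ge m$ for $i\neq j$ and $|q_j^k|\le M$ for all $j$. $V$ is defined for $\theta\in\mathbb{R}^N$ with $\theta_i\not\equiv\theta_j\pmod{2\pi}$ for $i\neq j$. Since $V$ is invariant under simultaneous rotation of all angles, its Hessian $V_{\theta\theta}$ always has the null vector $(1,\dots,1)^T$; a critical point $\theta$ of $V$ is called nondegenerate if $V_{\theta\theta}(\theta)$ has only one zero eigenvalue (i.e. a one-dimensional null space). *)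

(* Defs.v *)
From HB Require Import structures.
From mathcomp Require Import all_boot all_order all_algebra.
From mathcomp Require Import all_classical all_reals all_analysis.
Import Order.TTheory GRing.Theory Num.Theory.
Import numFieldNormedType.Exports.

Set Implicit Arguments.
Unset Strict Implicit.
Unset Printing Implicit Defensive.

Local Open Scope classical_set_scope.
Local Open Scope ring_scope.

Definition perp (R : realType) (p : R * R) : R * R := (- p.2, p.1).

(* The canonical norm `|p| of R * R is the sup norm, hence this definition. *)
Definition enorm (R : realType) (p : R * R) : R :=
  Num.sqrt (p.1 ^+ 2 + p.2 ^+ 2).

(* A configuration of N + 1 vortices is a function q : 'I_N.+1 -> R * R; the
   index ord0 is the strong vortex and lift ord0 i, for i : 'I_N, are the N
   others. *)
Definition circulation (R : realType) (N : nat) (eps : R) (i : 'I_N.+1) : R :=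
  if i == ord0 then 1 else eps.

Definition velocity (R : realType) (N : nat) (eps : R)
    (q : 'I_N.+1 -> R * R) (j : 'I_N.+1) : R * R :=
  \sum_(i < N.+1 | i != j)
    (circulation eps i / enorm (q j - q i) ^+ 2) *: perp (q j - q i).

(* Rigid rotation about the origin at rate 1 has velocity field perp. *)
Definition relative_equilibrium (R : realType) (N : nat) (eps : R)
    (q : 'I_N.+1 -> R * R) : Prop :=
  [/\ injective q,
      q ord0 = - eps *: \sum_(i < N) q (lift ord0 i) &
      forall j : 'I_N.+1, perp (q j) = velocity eps q j].

Definition relative_equilibrium_1N (R : realType) (N : nat)
    (q : 'I_N.+1 -> R * R) : Prop :=
  exists (eps_ : nat -> R) (q_ : nat -> 'I_N.+1 -> R * R),
    [/\ (forall k, eps_ k != 0) /\ (eps_ k @[k --> \oo] --> (0 : R)),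
        forall k, relative_equilibrium (eps_ k) (q_ k),
        forall j : 'I_N.+1, q_ k j @[k --> \oo] --> q j &
        exists m M : R,
          [/\ 0 < m, 0 < M,
              forall k (i j : 'I_N.+1), i != j -> m <= enorm (q_ k i - q_ k j) &
              forall k (j : 'I_N.+1), enorm (q_ k j) <= M]].

Definition polar (R : realType) (r t : R) : R * R := (r * cos t, r * sin t).

(* The vortices other than the strong one have the given polar coordinates;
   the strong one is placed so that the center of vorticity is the origin. *)
Definition polar_configuration (R : realType) (N : nat) (eps : R)
    (r theta : 'rV[R]_N) (j : 'I_N.+1) : R * R :=
  if unlift ord0 j is Some i then polar (r ord0 i) (theta ord0 i)
  else - eps *: \sum_(i < N) polar (r ord0 i) (theta ord0 i).

Definition potential (R : realType) (N : nat) (theta : 'rV[R]_N) : R :=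
  - \sum_(i < N) \sum_(j < N | (i < j)%N)
      (cos (theta ord0 i - theta ord0 j) +
       2^-1 * ln (2 - 2 * cos (theta ord0 i - theta ord0 j))).

Definition potential_domain (R : realType) (N : nat) : set 'rV[R]_N :=
  [set theta | forall i j : 'I_N, i != j ->
     forall k : int, theta ord0 i - theta ord0 j != k%:~R * (2 * pi)].

Definition partial (R : realType) (N : nat) (i : 'I_N) (f : 'rV[R]_N -> R)
    (x : 'rV[R]_N) : R :=
  'D_(delta_mx ord0 i) f x.

Definition hessian (R : realType) (N : nat) (f : 'rV[R]_N -> R)
    (x : 'rV[R]_N) : 'M[R]_N :=
  \matrix_(i, j) partial i (partial j f) x.

(* The potential is smooth on its (open) domain, so its partial derivatives
   there are genuine derivatives. *)
Definition critical_point (R : realType) (N : nat) (theta : 'rV[R]_N) : Prop :=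
  potential_domain theta /\ forall i : 'I_N, partial i (@potential R N) theta = 0.

(* kermx is the null space of the action on row vectors; the transpose makes
   it the null space of the Hessian acting on column vectors. *)
Definition nondegenerate_critical_point (R : realType) (N : nat)
    (theta : 'rV[R]_N) : Prop :=
  critical_point theta /\
  \rank (kermx (hessian (@potential R N) theta)^T) = 1%N.

(* Main.v *)
Require Import Defs.
From HB Require Import structures.
From mathcomp Require Import all_boot all_order all_algebra.
From mathcomp Require Import all_classical all_reals all_analysis.
From mathcomp Require Import ring lra.
Import Order.TTheory GRing.Theory Num.Theory.
Import numFieldNormedType.Exports.

Local Open Scope ring_scope.

(** Describe a configuration by the polar coordinates (r_j, theta_j) of the weak
    vortices relative to the strong one. The center of vorticity fixes the
    position of the strong vortex, and the equations of a relative equilibrium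
    of circulation e, projected on the radial and on the orthogonal direction
    of each weak vortex, become
      radial:   1 / r_j - r_j + e * (a smooth term) = 0,
      angular:  e * angular_j (r, theta, e) = 0,
    the equation of the strong vortex being a consequence of the others
    ([reduced_equilibrium]). After division of the second family by e, the
    system makes sense at e = 0; there the radial equations force r = 1, and
    the angular ones become - dV/dtheta_j = 0 ([angular1E] together with
    [partial_potential]). So (1, phi, 0) solves the system, and its solution is
    to be continued to small e <> 0.

    The obstacle is that the Hessian of V is singular, the problem being
    invariant under rotations. The same symmetry yields the cure: the
    interactions exert no total torque, so sum_j r_j * angular_j = 0
    identically ([torque_balance]). Replace the angular equations by
    angular_j + lambda = 0, where lambda = sum_i (theta_i - phi_i). Multiplying
    by r_j and summing gives lambda * sum_j r_j = 0, so lambda = 0 and nothing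
    has been changed ([equation_equilibrium]); but the Jacobian at (1, phi, 0)
    has become injective ([equation_jacobian]). Indeed its radial part is - 2
    times the identity in the radii, and a kernel vector b of the remaining part
    satisfies - (b H)_j + sum_i b_i = 0 for all j, H being the Hessian. The
    columns of H add up to 0 by torque balance, so sum_i b_i = 0, then b H = 0,
    and since (1, ..., 1) H = 0 by rotation invariance, nondegeneracy makes b a
    multiple of (1, ..., 1), hence b = 0.

    The continuation is the existence part of the implicit function theorem
    ([implicit_solution]): the Newton-like map x |-> x - F x * J^-1 with frozen
    Jacobian J is a contraction of a small ball. What makes it contracting is
    strict differentiability, a notion stable under sums, products and
    composition with real functions of class C^1, which moreover contains the
    directional derivatives by which the Hessian is defined. *)

Local Open Scope classical_set_scope.

Set Implicit Arguments.
Unset Strict Implicit.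
Unset Printing Implicit Defensive.

(** * Strict differentiability *)

Section StrictDerivative.
Context {R : realType} {V : normedModType R}.
Implicit Types (f h : V -> R) (p : V) (L : V -> R).

(** Strict differentiability: the two points of the difference quotient are
    both free near [p], so the remainder is small in Lipschitz norm. The bound
    on [L] is the continuity of the linear map [L]. *)
Definition strict_derivative f p L :=
  [/\ forall (a : R) u v, L (a *: u + v) = a * L u + L v,
      exists C : R, forall v, `|L v| <= C * `|v| &
      forall e : R, 0 < e -> \forall z \near (p, p),
        `|f z.1 - f z.2 - L (z.1 - z.2)| <= e * `|z.1 - z.2|].

Lemma strict_derivative0 f p L : strict_derivative f p L -> L 0 = 0.
Proof.
move=> [lL _ _]; have /eqP := lL 1 0 0; rewrite scale1r addr0 mul1r.
by rewrite -subr_eq subrr eq_sym => /eqP.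
Qed.

Lemma strict_derivative_lipschitz f p L : strict_derivative f p L ->
  exists2 C : R, 0 < C & \forall z \near (p, p),
    `|f z.1 - f z.2| <= C * `|z.1 - z.2|.
Proof.
move=> [_ [C LC] /(_ 1 ltr01) fL]; exists (`|C| + 1).
  by rewrite ltr_wpDl.
near=> z; rewrite -[X in `|X|](subrK (L (z.1 - z.2))).
rewrite (le_trans (ler_normD _ _))// mulrDl addrC lerD//; last by near: z.
by rewrite (le_trans (LC _))// ler_wpM2r// ler_norm.
Unshelve. all: by end_near. Qed.

Lemma strict_derivative_continuous f p L : strict_derivative f p L ->
  {for p, continuous f}.
Proof.
move=> /strict_derivative_lipschitz[C C0 fC].
apply/cvgrPdist_le => /= e e0.
have {fC} : \forall y \near p, `|f p - f y| <= C * `|p - y|.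
  have : (fun y : V => (p, y)) y @[y --> p] --> (p, p).
    by apply: cvg_pair => //=; exact: cvg_cst.
  by move=> /(_ _ fC).
move=> fC; near=> y; apply: (@le_trans _ _ (C * `|p - y|)); first by near: y.
rewrite -ler_pdivlMl//; near: y.
by apply: cvgr_dist_le; rewrite ?mulr_gt0// invr_gt0.
Unshelve. all: by end_near. Qed.

Lemma near_fst p (P : V -> Prop) :
  (\forall x \near p, P x) -> \forall z \near (p, p), P z.1.
Proof. by move=> pP; have := @cvg_fst _ _ (nbhs p) (nbhs p) _; apply. Qed.

Lemma near_snd p (P : V -> Prop) :
  (\forall x \near p, P x) -> \forall z \near (p, p), P z.2.
Proof. by move=> pP; have := @cvg_snd _ _ (nbhs p) (nbhs p) _; apply. Qed.

Lemma strict_derivative_cst c p : strict_derivative (fun=> c) p (fun=> 0).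
Proof.
split; first by move=> *; rewrite mulr0 addr0.
  by exists 0 => v; rewrite normr0 mul0r.
by move=> e e0; near=> z; rewrite !subrr normr0 mulr_ge0// ltW.
Unshelve. all: by end_near. Qed.

Lemma strict_derivativeD f h p Lf Lh :
  strict_derivative f p Lf -> strict_derivative h p Lh ->
  strict_derivative (fun x => f x + h x) p (fun v => Lf v + Lh v).
Proof.
move=> [lf [Cf bf] df] [lh [Ch bh] dh]; split.
- by move=> a u v; rewrite lf lh; ring.
- exists (Cf + Ch) => v.
  by rewrite (le_trans (ler_normD _ _))// mulrDl lerD.
move=> e e0; have e20 : 0 < e / 2 by rewrite divr_gt0.
near=> z.
rewrite (_ : _ - _ = (f z.1 - f z.2 - Lf (z.1 - z.2)) +
  (h z.1 - h z.2 - Lh (z.1 - z.2))); last by ring.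
rewrite (le_trans (ler_normD _ _))// [e in leRHS]splitr mulrDl lerD//; near: z.
- exact: df.
- exact: dh.
Unshelve. all: by end_near. Qed.

(** The remainder of a product splits into those of the two factors, plus two
    cross terms in which one factor is small by continuity and the other is
    bounded by a Lipschitz constant. *)
Lemma strict_derivativeM f h p Lf Lh :
  strict_derivative f p Lf -> strict_derivative h p Lh ->
  strict_derivative (fun x => f x * h x) p (fun v => h p * Lf v + f p * Lh v).
Proof.
move=> sf sh; have [lf [Cf bf] df] := sf; have [lh [Ch bh] dh] := sh.
have fp := strict_derivative_continuous sf.
have hp := strict_derivative_continuous sh.
have [Kf Kf0 lipf] := strict_derivative_lipschitz sf.
have [Kh Kh0 liph] := strict_derivative_lipschitz sh.
split.
- by move=> a u v; rewrite lf lh; ring.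
- exists (`|h p| * Cf + `|f p| * Ch) => v.
  by rewrite (le_trans (ler_normD _ _))// !normrM mulrDl -!mulrA lerD// ler_wpM2l.
move=> e e0.
pose A := `|h p| + `|f p| + Kf + Kh.
have A0 : 0 < A by rewrite /A -addrA ltr_wpDl ?addr_ge0 ?addr_gt0.
have eA0 : 0 < e / A by rewrite divr_gt0.
near=> z.
rewrite (_ : _ - _ = h p * (f z.1 - f z.2 - Lf (z.1 - z.2)) +
  f p * (h z.1 - h z.2 - Lh (z.1 - z.2)) + (h z.2 - h p) * (f z.1 - f z.2) +
  (f z.1 - f p) * (h z.1 - h z.2)); last by ring.
have -> : e * `|z.1 - z.2| =
    `|h p| * (e / A * `|z.1 - z.2|) + `|f p| * (e / A * `|z.1 - z.2|) +
    e / A * (Kf * `|z.1 - z.2|) + e / A * (Kh * `|z.1 - z.2|).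
  rewrite -[e in LHS](divfK (lt0r_neq0 A0)).
  by move: (e / A) => k; rewrite /A; ring.
rewrite (le_trans (ler_normD _ _))// lerD//; last first.
  rewrite normrM ler_pM//; last by near: z.
  near: z; apply: (@near_fst p (fun x => `|f x - f p| <= e / A)).
  exact: cvgr_distC_le.
rewrite (le_trans (ler_normD _ _))// lerD//; last first.
  rewrite normrM ler_pM//; last by near: z.
  near: z; apply: (@near_snd p (fun x => `|h x - h p| <= e / A)).
  exact: cvgr_distC_le.
rewrite (le_trans (ler_normD _ _))// lerD// normrM ler_wpM2l//; near: z.
- exact: df.
- exact: dh.
Unshelve. all: by end_near. Qed.

Lemma strict_derivative_comp f (h : R -> R) p L (d : R) :
  strict_derivative f p L ->
  (forall e : R, 0 < e -> \forall z \near (f p, f p),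
     `|h z.1 - h z.2 - d * (z.1 - z.2)| <= e * `|z.1 - z.2|) ->
  strict_derivative (fun x => h (f x)) p (fun v => d * L v).
Proof.
move=> sf dh; have [lf [Cf bf] df] := sf.
have fp := strict_derivative_continuous sf.
have [K K0 lipf] := strict_derivative_lipschitz sf.
split.
- by move=> a u v; rewrite lf; ring.
- by exists (`|d| * Cf) => v; rewrite normrM -mulrA ler_wpM2l.
move=> e e0.
pose A := K + `|d|.
have A0 : 0 < A by rewrite /A ltr_wpDr.
have eA0 : 0 < e / A by rewrite divr_gt0.
have {}dh : \forall z \near (p, p),
    `|h (f z.1) - h (f z.2) - d * (f z.1 - f z.2)|
    <= e / A * `|f z.1 - f z.2|.
  have [[A1 A2] /= [nA1 nA2] A12] := dh _ eA0.
  have fz1 := near_fst (fp _ nA1); have fz2 := near_snd (fp _ nA2).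
  by near=> z; apply: (A12 (f z.1, f z.2)); split; near: z.
near=> z.
rewrite (_ : _ - _ = (h (f z.1) - h (f z.2) - d * (f z.1 - f z.2)) +
  d * (f z.1 - f z.2 - L (z.1 - z.2))); last by ring.
have -> : e * `|z.1 - z.2| = e / A * (K * `|z.1 - z.2|) +
    `|d| * (e / A * `|z.1 - z.2|).
  rewrite -[e in LHS](divfK (lt0r_neq0 A0)).
  by move: (e / A) => k; rewrite /A; ring.
rewrite (le_trans (ler_normD _ _))// lerD//.
  rewrite (@le_trans _ _ (e / A * `|f z.1 - f z.2|))//; first by near: z.
  by rewrite ler_wpM2l ?(ltW eA0)//; near: z.
by rewrite normrM ler_wpM2l//; near: z; exact: df.
Unshelve. all: by end_near. Qed.

(** Fixing one of the two points turns strict differentiability into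
    differentiability, which is how the partial derivatives are read off. *)
Lemma strict_derivative_is_derive f p L v :
  strict_derivative f p L -> is_derive p v f (L v).
Proof.
move=> sf; have L0 := strict_derivative0 sf; have [lf _ df] := sf.
have : h^-1 *: (f (h *: v + p) - f p) @[h --> 0^'] --> L v.
  apply/cvgrPdist_le => e e0.
  have e0' : 0 < e / (`|v| + 1) by rewrite divr_gt0// ltr_wpDl.
  have : \forall h \near 0^', `|f (h *: v + p) - f p - L (h *: v + p - p)|
     <= e / (`|v| + 1) * `|h *: v + p - p|.
    have : (h *: v + p, p) @[h --> (0:R)^'] --> (p, p).
      apply: cvg_pair => /=; last exact: cvg_cst.
      apply: cvg_within_filter.
      have : (h *: v + p) @[h --> (0 : R)] --> 0 *: v + p.
        by apply: cvgD; [apply: cvgZ; [exact: cvg_id|exact: cvg_cst]|exact: cvg_cst].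
      by rewrite scale0r add0r.
    by move=> /(_ _ (df _ e0')).
  move=> H; near=> h.
  have h0 : h != 0 by near: h; exact: nbhs_dnbhs_neq.
  have Hh : `|f (h *: v + p) - f p - L (h *: v + p - p)|
     <= e / (`|v| + 1) * `|h *: v + p - p| by near: h.
  rewrite addrK in Hh.
  have Lh : L (h *: v) = h * L v by have := lf h v 0; rewrite addr0 L0 addr0.
  rewrite Lh in Hh.
  rewrite -[L v](mulKf h0) -mulrBr normrM normfV distrC ler_pdivrMl ?normr_gt0//.
  rewrite (le_trans Hh)// normrZ mulrCA ler_wpM2l//.
  rewrite mulrAC ler_pdivrMr ?ltr_wpDl// ler_wpM2l ?ltW//.
  by rewrite ltrDl.
move=> H; apply: DeriveDef; first by apply/cvg_ex; exists (L v).
exact: cvg_lim.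
Unshelve. all: by end_near. Qed.

End StrictDerivative.

Section ContinuouslyDerivable.
Context {R : realType}.

(** By the mean value theorem, the slope of a chord near [a] is a value of the
    derivative near [a]. *)
Lemma strict_derivative_C1 (h dh : R -> R) (a : R) :
  (\forall x \near a, is_derive (x : R) 1 h (dh x)) -> {for a, continuous dh} ->
  forall e : R, 0 < e -> \forall z \near (a, a),
     `|h z.1 - h z.2 - dh a * (z.1 - z.2)| <= e * `|z.1 - z.2|.
Proof.
move=> hd cdh e e0.
have : \forall x \near a, is_derive (x : R) 1 h (dh x) /\ `|dh x - dh a| <= e.
  near=> x; split; first by near: x.
  by near: x; exact: cvgr_distC_le.
move=> /nbhs_ballP[r /= r0 rP].
have H x y : ball a r x -> ball a r y -> x <= y ->
    `|h y - h x - dh a * (y - x)| <= e * `|y - x|.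
  move=> ax ay xy.
  have xyr c : c \in `[x, y]%R -> ball a r c.
    move: ax ay; rewrite /ball/= in_itv/= !ltr_distlC => /andP[? ?] /andP[? ?].
    by move=> /andP[? ?]; apply/andP; split; lra.
  have [||c cxy ->] := @MVT_segment R h dh x y xy.
  - by move=> c cxy; apply: (rP c _).1; apply: xyr; exact: subset_itv_oo_cc.
  - apply: derivable_within_continuous => c /xyr /rP[? _].
    exact: ex_derive.
  rewrite -mulrBl normrM ler_wpM2r//.
  exact: (rP c (xyr _ cxy)).2.
have [rx ry] : (\forall z \near (a, a), ball a r z.1) /\
    (\forall z \near (a, a), ball a r z.2).
  by split; [apply: near_fst|apply: near_snd]; exact: nbhsx_ballx.
near=> z.
have z1 : ball a r z.1 by near: z.
have z2 : ball a r z.2 by near: z.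
have [zz|/ltW zz] := leP z.2 z.1; first exact: H.
rewrite -normrN [leRHS](_ : _ = e * `|z.2 - z.1|); last by rewrite distrC.
rewrite (_ : - (_ - _ - _) = h z.2 - h z.1 - dh a * (z.2 - z.1)); last by ring.
exact: H.
Unshelve. all: by end_near. Qed.

End ContinuouslyDerivable.

Lemma derive_invariant (R : realType) (V W : normedModType R) (f : V -> W)
    (a v : V) :
  (forall h : R, f (h *: v + a) = f a) -> 'D_v f a = 0.
Proof.
move=> fi; rewrite /derive (_ : (fun h => _) = cst 0) ?lim_cst//.
by apply/funext => h /=; rewrite fi subrr scaler0.
Qed.

(** * Solving a system of equations near a known solution *)

(** Completeness of the space of unknowns, for the contraction principle. *)
HB.instance Definition _ (R : realType) m n := Complete.on 'M[R]_(m, n).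

Section MatrixNorm.
Context {R : realType}.

Lemma mx_entry_le m n (M : 'M[R]_(m, n)) i j : `|M i j| <= `|M|.
Proof.
rewrite [leRHS]/Num.Def.normr/= mx_normrE.
exact: (le_bigmax _ (fun ij : 'I_m * 'I_n => `|M ij.1 ij.2|) (i, j)).
Qed.

Lemma mx_norm_le m n (M : 'M[R]_(m, n)) c :
  0 <= c -> (forall i j, `|M i j| <= c) -> `|M| <= c.
Proof.
move=> c0 Mc; rewrite [leLHS]/Num.Def.normr/= mx_normrE.
by apply/bigmax_leP; split=> //= ij _; exact: Mc.
Qed.

Lemma mulmx_bounded m n (B : 'M[R]_(m, n)) :
  exists2 C : R, 0 < C & forall v : 'rV_m, `|v *m B| <= C * `|v|.
Proof.
exists (1 + \sum_(k < m) `|B|) => [|v].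
  by rewrite ltr_wpDr// sumr_ge0.
apply: mx_norm_le => [|i j]; first by rewrite mulr_ge0// addr_ge0// sumr_ge0.
rewrite mxE (le_trans (ler_norm_sum _ _ _))//.
rewrite (@le_trans _ _ (\sum_(k < m) `|B| * `|v|))//.
  by apply: ler_sum => k _; rewrite normrM mulrC ler_pM// mx_entry_le.
by rewrite -mulr_suml ler_wpM2r// lerDr.
Qed.

Lemma row_mx_norm_le m n (u : 'rV[R]_m) (w : 'rV[R]_n) c :
  `|u| <= c -> `|w| <= c -> `|row_mx u w| <= c.
Proof.
move=> uc wc; apply: mx_norm_le => [|i j]; first by rewrite (le_trans _ uc).
rewrite -(splitK j); case: (fintype.split j) => k /=; rewrite ?row_mxEl ?row_mxEr.
  by rewrite (le_trans (mx_entry_le _ _ _)).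
by rewrite (le_trans (mx_entry_le _ _ _)).
Qed.

End MatrixNorm.

Section ImplicitFunction.
Context {R : realType} {n : nat}.

(** Existence part of the implicit function theorem, with the last coordinate as
    the given variable. The fixed points of [x |-> x - F x * J^-1], where [J] is
    the partial Jacobian at the base point, are the zeros of [F]; strict
    differentiability makes this map a contraction near [x0], and continuity in
    [e] keeps it inside a small closed ball around [x0]. *)
Lemma implicit_solution (f : 'I_n -> 'rV[R]_(n + 1) -> R)
    (L : 'I_n -> 'rV[R]_(n + 1) -> R) (x0 : 'rV[R]_n) :
  let p := row_mx x0 (const_mx 0) : 'rV[R]_(n + 1) in
  (forall i, strict_derivative (f i) p (L i)) ->
  (forall i, f i p = 0) ->
  (forall v : 'rV_n, (forall i, L i (row_mx v 0) = 0) -> v = 0) ->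
  forall d : R, 0 < d -> exists2 e0 : R, 0 < e0 & forall e, `|e| < e0 ->
    exists2 x, `|x0 - x| <= d & forall i, f i (row_mx x (const_mx e)) = 0.
Proof.
move=> p sf fp0 injL d d0.
pose A := \matrix_(k < n, i < n) L i (row_mx (delta_mx 0 k) 0).
have LA i (v : 'rV_n) : L i (row_mx v 0) = (v *m A) 0 i.
  have [lL _ _] := sf i; have L0 := strict_derivative0 (sf i).
  rewrite {1}(row_sum_delta v) mxE.
  elim/big_rec2 : _ => [|k y w _ IH]; first by rewrite row_mx0 L0.
  by rewrite mxE -IH -lL scale_row_mx add_row_mx scaler0 addr0.
have Au : A \in unitmx.
  rewrite -row_free_unit; apply: inj_row_free => v vA.
  by apply: injL => i; rewrite LA vA mxE.
have [C C0 bC] := mulmx_bounded (invmx A).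
(* With this bound on the remainder, T below has Lipschitz constant 1/2. *)
pose kp := (2 * C)^-1.
have kp0 : 0 < kp by rewrite invr_gt0 mulr_gt0.
have [r1 r10 r1P] : exists2 r : R, 0 < r & forall z1 z2 i,
    `|p - z1| < r -> `|p - z2| < r ->
    `|f i z1 - f i z2 - L i (z1 - z2)| <= kp * `|z1 - z2|.
  have : \forall z \near (p, p), forall i,
      `|f i z.1 - f i z.2 - L i (z.1 - z.2)| <= kp * `|z.1 - z.2|.
    apply: (@filter_forall _ _ (fun i z =>
      `|f i z.1 - f i z.2 - L i (z.1 - z.2)| <= kp * `|z.1 - z.2|)
      (nbhs (p, p)) _) => i.
    by have [_ _] := sf i; apply.
  move=> /nbhs_ballP[r /= r0 rP]; exists r => // z1 z2 i pz1 pz2.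
  by apply: (rP (z1, z2)); split; rewrite -ball_normE.
pose r := Num.min d (r1 / 2).
have r0 : 0 < r by rewrite lt_min d0 divr_gt0.
(* T then moves the center x0 by at most r / 2, so it preserves the ball. *)
have [r2 r20 r2P] : exists2 r2 : R, 0 < r2 & forall z i,
    `|p - z| < r2 -> `|f i z| <= kp * r.
  have : \forall z \near p, forall i, `|f i z| <= kp * r.
    apply: (@filter_forall _ _ (fun i z => `|f i z| <= kp * r) (nbhs p) _) => i.
    have /cvgrPdist_le := strict_derivative_continuous (sf i).
    move=> /(_ (kp * r)); rewrite mulr_gt0// fp0 => /(_ isT).
    by apply: filterS => z; rewrite sub0r normrN.
  move=> /nbhs_ballP[r2 /= r20 rP]; exists r2 => // z i pz.
  by apply: rP; rewrite -ball_normE.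
exists (Num.min r1 r2); first by rewrite lt_min r10.
move=> e; rewrite lt_min => /andP[er1 er2].
pose z x : 'rV[R]_(n + 1) := row_mx x (const_mx e).
pose F x := \row_i f i (z x).
pose T x := x - F x *m invmx A.
have pz x : p - z x = row_mx (x0 - x) (const_mx (- e)).
  rewrite /p /z opp_row_mx add_row_mx; congr row_mx.
  by apply/rowP => j; rewrite !mxE sub0r.
have pzr x : `|x0 - x| <= r -> `|p - z x| < r1.
  move=> xr; apply: (@le_lt_trans _ _ (Num.max (r1 / 2) `|e|)).
    rewrite pz row_mx_norm_le//.
      by rewrite le_max (le_trans xr)// ge_min lexx orbT.
    apply: mx_norm_le => [|i j]; first by rewrite le_max normr_ge0 orbT.
    by rewrite mxE normrN le_max lexx orbT.
  by rewrite gt_max er1 ltr_pdivrMr// mulr_natr mulr2n ltrDl r10.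
have Tlip x y : `|x0 - x| <= r -> `|x0 - y| <= r ->
    `|T x - T y| <= 2^-1 * `|x - y|.
  move=> xr yr.
  have -> : T x - T y = ((x - y) *m A - (F x - F y)) *m invmx A.
    rewrite mulmxBl mulmxK// mulmxBl /T opprD opprK addrACA.
    by rewrite opprB (addrC (_ *m _)) .
  rewrite (le_trans (bC _))//.
  have -> : 2^-1 * `|x - y| = C * (kp * `|x - y|).
    by rewrite /kp; field; rewrite lt0r_neq0.
  rewrite ler_wpM2l ?(ltW C0)//; apply: mx_norm_le => [|i j].
    by rewrite mulr_ge0// ltW.
  have zxy : z x - z y = row_mx (x - y) 0.
    by rewrite /z opp_row_mx add_row_mx subrr.
  rewrite ord1 (_ : ((x - y) *m A - (F x - F y)) 0 j =
    - (f j (z x) - f j (z y) - L j (z x - z y))); last first.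
    by rewrite zxy LA !mxE; ring.
  rewrite normrN.
  rewrite (le_trans (r1P _ _ _ _ _))// ?pzr// ler_wpM2l ?(ltW kp0)//.
  by rewrite zxy row_mx_norm_le// normr0.
pose U := closed_ball x0 r.
have UE x : U x <-> `|x0 - x| <= r by rewrite /U closed_ballE.
have x0r : `|x0 - x0| <= r by rewrite subrr normr0 ltW.
have TU : {homo T : x / U x >-> U x}.
  move=> x /UE xr; apply/UE.
  rewrite (_ : x0 - T x = F x0 *m invmx A + (T x0 - T x)); last first.
    by rewrite /T addrA addrCA subrr addr0.
  rewrite (le_trans (ler_normD _ _))// (splitr r) lerD//; last first.
    by rewrite (le_trans (Tlip _ _ _ _))// mulrC ler_wpM2r// invr_ge0.
  rewrite (le_trans (bC _))//.
  rewrite (_ : r / 2 = C * (kp * r)); last first.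
    by rewrite /kp; field; rewrite lt0r_neq0.
  rewrite ler_wpM2l ?(ltW C0)//; apply: mx_norm_le => [|i j].
    by rewrite mulr_ge0// ltW.
  rewrite mxE r2P// pz subrr (le_lt_trans _ er2)// row_mx_norm_le// ?normr0//.
  by apply: mx_norm_le => // k l; rewrite mxE normrN.
have ctr : is_contraction (mkfun_fun TU).
  exists (2^-1)%:nng; split; first by rewrite /= invf_lt1// ltr1n.
  by move=> [x y] /= [/UE xr /UE yr]; exact: Tlip.
have [||x Ux xT] := banach_fixed_point ctr.
- exact: closed_ball_closed.
- by exists x0; apply/UE.
exists x; first by have /UE/le_trans -> := Ux; rewrite // ge_min lexx.
have : F x *m invmx A = 0.
  by move/eqP: xT; rewrite /= /mkfun /T -subr_eq0 opprB addrC subrK => /eqP.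
move=> /(congr1 (mulmx^~ A)); rewrite mulmxKV// mul0mx => F0 i.
by move/rowP: F0 => /(_ i); rewrite !mxE.
Qed.

End ImplicitFunction.

(** * Calculus rules and the gradient of the potential *)

Section StrictRules.
Context {R : realType} {V : normedModType R}.
Implicit Types (f h : V -> R) (p : V) (L : V -> R).

Lemma strict_derivative_eq f f' p L L' : f =1 f' -> L =1 L' ->
  strict_derivative f p L -> strict_derivative f' p L'.
Proof. by move=> /funext -> /funext ->. Qed.

Lemma strict_derivativeZ (c : R) f p L : strict_derivative f p L ->
  strict_derivative (fun x => c * f x) p (fun v => c * L v).
Proof.
move=> sf.
apply: strict_derivative_eq (strict_derivativeM (strict_derivative_cst c p) sf)
  => // v.
by rewrite mulr0 add0r.
Qed.

Lemma strict_derivativeB f h p Lf Lh :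
  strict_derivative f p Lf -> strict_derivative h p Lh ->
  strict_derivative (fun x => f x - h x) p (fun v => Lf v - Lh v).
Proof.
move=> sf sh.
by apply: strict_derivative_eq
  (strict_derivativeD sf (strict_derivativeZ (-1) sh)) => v; rewrite mulN1r.
Qed.

Lemma strict_derivative_sum (I : Type) (r : seq I) (P : pred I)
    (F : I -> V -> R) (L : I -> V -> R) p :
  (forall i, P i -> strict_derivative (F i) p (L i)) ->
  strict_derivative (fun x => \sum_(i <- r | P i) F i x) p
    (fun v => \sum_(i <- r | P i) L i v).
Proof.
move=> sF; elim: r => [|i r IH].
  by apply: strict_derivative_eq (strict_derivative_cst 0 p) => x; rewrite big_nil.
have [Pi|Pi] := boolP (P i).
  by apply: strict_derivative_eq (strict_derivativeD (sF i Pi) IH) => x;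
    rewrite big_cons Pi.
by apply: strict_derivative_eq IH => x; rewrite big_cons (negPf Pi).
Qed.

Lemma strict_derivative_comp_C1 f (h dh : R -> R) p L :
  strict_derivative f p L ->
  (\forall x \near f p, is_derive (x : R) 1 h (dh x)) ->
  {for f p, continuous dh} ->
  strict_derivative (fun x => h (f x)) p (fun v => dh (f p) * L v).
Proof.
move=> sf hd cd; apply: strict_derivative_comp => //.
exact: strict_derivative_C1.
Qed.

Lemma strict_derivativeV f p L : f p != 0 -> strict_derivative f p L ->
  strict_derivative (fun x => (f x)^-1) p (fun v => - (f p) ^- 2 * L v).
Proof.
move=> fp0 sf; apply: (@strict_derivative_comp_C1 f (fun x => x^-1) (fun x => - x ^- 2))
  => //.
  have : \forall x \near f p, x != 0.
    by apply: open_nbhs_nbhs; split => //; exact: open_neq.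
  apply: filterS => x x0.
  apply: DeriveDef; first exact: derivableV.
  by rewrite deriveV//= derive_id [LHS]mulr1.
apply: continuousN; apply: continuousV; first by rewrite expf_neq0.
exact: exprn_continuous.
Qed.

Definition strictly_differentiable f p := exists L, strict_derivative f p L.

Lemma strictly_differentiable_continuous f p :
  strictly_differentiable f p -> {for p, continuous f}.
Proof. by move=> [L]; exact: strict_derivative_continuous. Qed.

Lemma strictly_differentiable_cst c p : strictly_differentiable (fun=> c) p.
Proof. by exists (fun=> 0); exact: strict_derivative_cst. Qed.

Lemma strictly_differentiableD f h p : strictly_differentiable f p ->
  strictly_differentiable h p -> strictly_differentiable (fun x => f x + h x) p.
Proof. by move=> [Lf sf] [Lh sh]; eexists; exact: strict_derivativeD sf sh. Qed.

Lemma strictly_differentiableB f h p : strictly_differentiable f p ->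
  strictly_differentiable h p -> strictly_differentiable (fun x => f x - h x) p.
Proof. by move=> [Lf sf] [Lh sh]; eexists; exact: strict_derivativeB sf sh. Qed.

Lemma strictly_differentiableM f h p : strictly_differentiable f p ->
  strictly_differentiable h p -> strictly_differentiable (fun x => f x * h x) p.
Proof. by move=> [Lf sf] [Lh sh]; eexists; exact: strict_derivativeM sf sh. Qed.

Lemma strictly_differentiableV f p : f p != 0 -> strictly_differentiable f p ->
  strictly_differentiable (fun x => (f x)^-1) p.
Proof. by move=> fp0 [Lf sf]; eexists; exact: strict_derivativeV fp0 sf. Qed.

Lemma strictly_differentiable_sum (I : Type) (r : seq I) (P : pred I)
    (F : I -> V -> R) p :
  (forall i, P i -> strictly_differentiable (F i) p) ->
  strictly_differentiable (fun x => \sum_(i <- r | P i) F i x) p.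
Proof.
move=> sF; have /choice[L LP] :
    forall i, exists L, P i -> strict_derivative (F i) p L.
  move=> i; have [/sF[L sL]|_] := boolP (P i); first by exists L.
  by exists (fun=> 0).
by eexists; exact: strict_derivative_sum LP.
Qed.

Lemma strictly_differentiable_cos f p : strictly_differentiable f p ->
  strictly_differentiable (fun x => cos (f x)) p.
Proof.
move=> [Lf sf]; eexists; apply: (strict_derivative_comp_C1 sf).
  by near=> x; exact: is_derive_cos.
by apply: continuousN; exact: continuous_sin.
Unshelve. all: by end_near. Qed.

Lemma strictly_differentiable_sin f p : strictly_differentiable f p ->
  strictly_differentiable (fun x => sin (f x)) p.
Proof.
move=> [Lf sf]; eexists; apply: (strict_derivative_comp_C1 sf).
  by near=> x; exact: is_derive_sin.
exact: continuous_cos.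
Unshelve. all: by end_near. Qed.

End StrictRules.

Section Potential.
Context {R : realType}.

Lemma strict_derivative_coord m (p : 'rV[R]_m) (k : 'I_m) :
  strict_derivative (fun z : 'rV[R]_m => z 0 k) p (fun v => v 0 k).
Proof.
split.
- by move=> a u v; rewrite !mxE.
- by exists 1 => v; rewrite mul1r mx_entry_le.
- move=> e e0; near=> z.
  by rewrite !mxE subrr normr0 mulr_ge0// ltW.
Unshelve. all: by end_near. Qed.

(** The derivative of [cos x + ln (2 - 2 * cos x) / 2]. *)
Definition pair_force (x : R) : R := sin x * ((2 - 2 * cos x)^-1 - 1).

Lemma pair_forceN x : pair_force (- x) = - pair_force x.
Proof. by rewrite /pair_force cosN sinN mulNr. Qed.

Lemma two_minus_2cos_gt0 (x : R) : cos x != 1 -> 0 < 2 - 2 * cos x.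
Proof. by move=> x1; rewrite subr_gt0 gtr_pMr// lt_neqAle x1 cos_le1. Qed.

Lemma strict_derivative_pair (m : nat) (p : 'rV[R]_m) (i j : 'I_m) :
  cos (p 0 i - p 0 j) != 1 ->
  strict_derivative (fun t : 'rV[R]_m =>
     cos (t 0 i - t 0 j) + 2^-1 * ln (2 - 2 * cos (t 0 i - t 0 j))) p
   (fun v => pair_force (p 0 i - p 0 j) * (v 0 i - v 0 j)).
Proof.
move=> p1; set d := fun t : 'rV[R]_m => t 0 i - t 0 j.
have sd : strict_derivative d p (fun v => v 0 i - v 0 j).
  by apply: strict_derivativeB; exact: strict_derivative_coord.
have scos : strict_derivative (fun t => cos (d t)) p
    (fun v => - sin (d p) * (v 0 i - v 0 j)).
  apply: (@strict_derivative_comp_C1 _ _ d (@cos R) (fun x => - sin x) _ _ sd).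
    by near=> x; exact: is_derive_cos.
  by apply: continuousN; exact: continuous_sin.
have D0 := two_minus_2cos_gt0 p1.
have sln := strict_derivative_comp_C1
  (strict_derivativeB (strict_derivative_cst 2 p) (strict_derivativeZ 2 scos)).
apply: strict_derivative_eq (strict_derivativeD scos
  (strict_derivativeZ 2^-1 (sln (@ln R) (@GRing.inv R) _ _))) => [//|v||].
- by rewrite /pair_force -/(d p); field; rewrite lt0r_neq0.
- have : \forall x \near 2 - 2 * cos (d p), 0 < x.
    by apply: open_nbhs_nbhs; split => //; exact: open_gt.
  by apply: filterS => x; exact: is_derive1_ln.
- by apply: inv_continuous; rewrite lt0r_neq0.
Unshelve. all: by end_near. Qed.

(** [pair_force] being odd, the pairs on both sides of [k] contribute alike. *)
Lemma partial_potential N (k : 'I_N) (theta : 'rV[R]_N) :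
  (forall i j, i != j -> cos (theta 0 i - theta 0 j) != 1) ->
  partial k (@potential R N) theta =
    - \sum_(i < N | i != k) pair_force (theta 0 k - theta 0 i).
Proof.
move=> theta1; pose F i j := pair_force (theta 0 i - theta 0 j).
have FN i j : F j i = - F i j by rewrite /F -pair_forceN opprB.
have sV : strict_derivative (@potential R N) theta
    (fun v => -1 * \sum_(i < N) \sum_(j < N | (i < j)%N)
       F i j * (v 0 i - v 0 j)).
  have -> : @potential R N = (fun t => -1 * \sum_(i < N)
      \sum_(j < N | (i < j)%N) (cos (t 0 i - t 0 j) +
         2^-1 * ln (2 - 2 * cos (t 0 i - t 0 j)))).
    by apply/funext => t; rewrite mulN1r.
  apply: strict_derivativeZ.
  do 2![apply: strict_derivative_sum => ? ?].
  by apply/strict_derivative_pair/theta1; rewrite -val_eqE ltn_eqF.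
rewrite /partial.
rewrite (@derive_val _ _ _ _ _ _ _ (strict_derivative_is_derive _ sV)) mulN1r.
congr (- _).
under eq_bigr do (under eq_bigr do rewrite mulrBr; rewrite sumrB).
rewrite sumrB [X in _ - X](exchange_big_dep predT)//=.
have D (A : 'I_N -> R) :
    \sum_(i < N) A i * (delta_mx 0 k : 'rV[R]_N) 0 i = A k.
  rewrite (bigD1 k)//= big1 ?addr0; first by rewrite mxE !eqxx mulr1.
  by move=> i ik; rewrite mxE (negPf ik) andbF mulr0.
under eq_bigr do rewrite -mulr_suml.
under [X in _ - X]eq_bigr do rewrite -mulr_suml.
rewrite !D [RHS](bigID (fun i : 'I_N => (k < i)%N))/= -sumrN; congr (_ + _).
  by apply: eq_bigl => i; rewrite -val_eqE/=; case: ltngtP.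
rewrite [LHS](eq_bigr (fun i => F k i)); last by move=> i _; rewrite FN opprK.
by apply: eq_bigl => i; rewrite -val_eqE/=; case: ltngtP.
Qed.

End Potential.

(** * Vortex equations relative to the strong vortex *)

Section ReducedSystem.
Context {R : realType} {N : nat}.
Implicit Types (z : 'rV[R]_(N + N + 1)) (i j : 'I_N).

(** A point of the unknown space: the radii, the angles and the circulation. *)
Definition chart (r theta : 'rV[R]_N) (e : R) : 'rV[R]_(N + N + 1) :=
  row_mx (row_mx r theta) (const_mx e).

(** The polar coordinates of the weak vortices are taken relative to the strong
    vortex, not to the origin; the interaction with the strong vortex is then
    purely radial. *)
Definition rad z i := z 0 (lshift 1 (lshift N i)).
Definition ang z i := z 0 (lshift 1 (rshift N i)).
Definition eps z := z 0 (rshift (N + N) 0).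

Lemma rad_chart r theta e i : rad (chart r theta e) i = r 0 i.
Proof. by rewrite /rad /chart !row_mxEl. Qed.

Lemma ang_chart r theta e i : ang (chart r theta e) i = theta 0 i.
Proof. by rewrite /ang /chart row_mxEl row_mxEr. Qed.

Lemma eps_chart r theta e : eps (chart r theta e) = e.
Proof. by rewrite /eps /chart row_mxEr mxE. Qed.

Definition xrel z i := rad z i * cos (ang z i).
Definition yrel z i := rad z i * sin (ang z i).

Definition sqdist z i j :=
  (xrel z j - xrel z i) ^+ 2 + (yrel z j - yrel z i) ^+ 2.

(** If the weak vortices have positions u_i relative to the strong one, the
    center of vorticity is the origin when the strong one is at
    - e * kappa * sum_i u_i. *)
Definition kappa z := (1 + N%:R * eps z)^-1.

(** One coordinate ([c] being the abscissas or the ordinates) of the part of the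
    equation of vortex [j] that carries a factor [eps z]: the interaction with
    the other weak vortices and the displacement of the strong one. *)
Definition drift z (c : 'I_N -> R) j :=
  \sum_(i < N | i != j) (c j - c i) / sqdist z i j + kappa z * \sum_i c i.

Definition radial z j := (rad z j)^-1 - rad z j +
  eps z * (cos (ang z j) * drift z (xrel z) j + sin (ang z j) * drift z (yrel z) j).

(** The orthogonal component of the equation of vortex [j] is [eps z] times this
    quantity, which is still meaningful for [eps z = 0]. *)
Definition angular z j :=
  cos (ang z j) * drift z (yrel z) j - sin (ang z j) * drift z (xrel z) j.

Lemma sqdist_chart1 t e i j :
  sqdist (chart (const_mx 1) t e) i j = 2 - 2 * cos (t 0 i - t 0 j).
Proof.
rewrite /sqdist /xrel /yrel !rad_chart !ang_chart !mxE !mul1r cosB.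
by rewrite !sqrrB !cos2sin2; ring.
Qed.

Lemma sqdistC z i j : sqdist z i j = sqdist z j i.
Proof. by rewrite /sqdist; ring. Qed.

Lemma sum_antisym (F : 'I_N -> 'I_N -> R) : (forall i j, F i j = - F j i) ->
  \sum_j \sum_(i | i != j) F i j = 0.
Proof.
move=> FN; set S := LHS.
have : S = - S.
  rewrite {1}/S (exchange_big_dep predT)//= -sumrN; apply: eq_bigr => i _.
  by rewrite -sumrN; apply: eq_big => [j|j _]; [rewrite eq_sym|rewrite FN].
by move=> SN; lra.
Qed.

(** The mutual forces of the weak vortices are opposite and central, so their
    torques cancel in pairs, and the torque of the displacement term is the
    cross product of a vector with itself. *)
Lemma torque_balance z : \sum_j rad z j * angular z j = 0.
Proof.
pose x := xrel z; pose y := yrel z.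
transitivity (\sum_j (x j * drift z y j - y j * drift z x j)).
  by apply: eq_bigr => j _; rewrite /angular /x /y /xrel /yrel; ring.
pose F i j := (x i * y j - y i * x j) / sqdist z i j.
have F0 : \sum_j \sum_(i | i != j) F i j = 0.
  by apply: sum_antisym => i j; rewrite /F sqdistC; ring.
rewrite (eq_bigr (fun j => \sum_(i | i != j) F i j +
    (kappa z * (\sum_i y i) * x j - kappa z * (\sum_i x i) * y j))).
  by rewrite big_split/= F0 add0r sumrB -!mulr_sumr; ring.
move=> j _; rewrite (_ : \sum_(i | i != j) F i j =
    x j * (\sum_(i | i != j) (y j - y i) / sqdist z i j)
    - y j * (\sum_(i | i != j) (x j - x i) / sqdist z i j)).
  by rewrite /drift; ring.
by rewrite !mulr_sumr -sumrB; apply: eq_bigr => i _; rewrite /F; ring.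
Qed.

Lemma sum_drift z c : \sum_j drift z c j = N%:R * kappa z * \sum_i c i.
Proof.
rewrite /drift big_split/= sum_antisym ?add0r.
  by rewrite sumr_const card_ord -[LHS]mulr_natl mulrA.
by move=> i j; rewrite sqdistC; ring.
Qed.

Definition configuration z (j : 'I_N.+1) : R * R :=
  let q0 := (- (eps z * kappa z * \sum_i xrel z i),
             - (eps z * kappa z * \sum_i yrel z i)) in
  if unlift ord0 j is Some i then (xrel z i, yrel z i) + q0 else q0.

(** The equation of the strong vortex follows from those of the weak ones: in
    their sum the mutual interactions cancel in pairs, and what remains is the
    balance at the strong vortex. The two coordinates are alike, so [c] stands
    for either of them. *)
Lemma equilibrium_coordinate z (c : 'I_N -> R) (a : 'I_N.+1 -> R)
    (d2 : 'I_N.+1 -> 'I_N.+1 -> R) (j : 'I_N.+1) :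
  1 + N%:R * eps z != 0 ->
  (forall i, c i / rad z i ^+ 2 + eps z * drift z c i = c i) ->
  a ord0 = - (eps z * kappa z * \sum_i c i) ->
  (forall i, a (lift ord0 i) = c i - eps z * kappa z * \sum_i c i) ->
  (forall i, d2 ord0 (lift ord0 i) = rad z i ^+ 2) ->
  (forall i, d2 (lift ord0 i) ord0 = rad z i ^+ 2) ->
  (forall i k, d2 (lift ord0 k) (lift ord0 i) = sqdist z i k) ->
  a j = \sum_(i < N.+1 | i != j) (circulation (eps z) i / d2 j i) *: (a j - a i).
Proof.
move=> k0 H a0 al d0l dl0 dll; rewrite /GRing.scale/=.
case: (unliftP ord0 j) => [k|] ->; rewrite big_mkcond big_ord_recl/=.
  rewrite dl0 al a0 -[LHS](_ : c k / rad z k ^+ 2 + eps z * drift z c k -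
    eps z * kappa z * \sum_i c i = _); last by rewrite H.
  rewrite /drift mulrDr mulrA addrA addrK.
  congr (_ + _); first by rewrite opprK subrK mul1r mulrC.
  rewrite -big_mkcond mulr_sumr; apply: eq_big => [i|i _].
    by rewrite (inj_eq (@lift_inj _ _)).
  by rewrite dll !al /circulation/=; ring.
rewrite add0r a0.
rewrite [RHS](eq_bigr (fun i => - eps z * (c i / rad z i ^+ 2))); last first.
  by move=> i _; rewrite d0l al /circulation/=; ring.
rewrite -mulr_sumr mulNr; congr (- _); rewrite -mulrA; congr (_ * _).
rewrite [RHS](_ : _ = \sum_i (c i - eps z * drift z c i)).
  by rewrite sumrB -mulr_sumr sum_drift /kappa; field.
by apply: eq_bigr => i _; rewrite -[in RHS]H addrK.
Qed.

Lemma enorm_sqr (p : R * R) : enorm p ^+ 2 = p.1 ^+ 2 + p.2 ^+ 2.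
Proof. by rewrite sqr_sqrtr// addr_ge0// sqr_ge0. Qed.

Lemma perp_sum (I : Type) (r : seq I) (P : pred I) (a : I -> R)
    (u : I -> R * R) :
  \sum_(i <- r | P i) a i *: perp (u i) = perp (\sum_(i <- r | P i) a i *: u i).
Proof.
elim/big_rec2 : _ => [|i p q _ ->]; first by rewrite /perp oppr0.
by apply: injective_projections; rewrite //= scalerN opprD.
Qed.

Lemma fst_sum (I : Type) (r : seq I) (P : pred I) (u : I -> R * R) :
  (\sum_(i <- r | P i) u i).1 = \sum_(i <- r | P i) (u i).1.
Proof. by elim/big_rec2 : _ => //= i p q _ ->. Qed.

Lemma snd_sum (I : Type) (r : seq I) (P : pred I) (u : I -> R * R) :
  (\sum_(i <- r | P i) u i).2 = \sum_(i <- r | P i) (u i).2.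
Proof. by elim/big_rec2 : _ => //= i p q _ ->. Qed.

Lemma configuration_lift z i : configuration z (lift ord0 i) =
  (xrel z i - eps z * kappa z * \sum_i xrel z i,
   yrel z i - eps z * kappa z * \sum_i yrel z i).
Proof. by rewrite /configuration liftK. Qed.

Lemma configuration0 z : configuration z ord0 =
  (- (eps z * kappa z * \sum_i xrel z i),
   - (eps z * kappa z * \sum_i yrel z i)).
Proof. by rewrite /configuration unlift_none. Qed.

(** A vector is determined by its components along (c, s) and (- s, c). *)
Lemma polar_frame (c s r e X Y : R) : c ^+ 2 + s ^+ 2 = 1 -> r != 0 ->
  r^-1 - r + e * (c * X + s * Y) = 0 -> c * Y - s * X = 0 ->
  r * c / r ^+ 2 + e * X = r * c /\ r * s / r ^+ 2 + e * Y = r * s.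
Proof.
move=> cs r0 Hr Ha.
have rV : r^-1 = r - e * (c * X + s * Y) by rewrite -[LHS]subr0 -Hr; ring.
have hX : X = c * (c * X + s * Y).
  transitivity ((c ^+ 2 + s ^+ 2) * X + s * (c * Y - s * X)); last by ring.
  by rewrite cs Ha; ring.
have hY : Y = s * (c * X + s * Y).
  transitivity ((c ^+ 2 + s ^+ 2) * Y - c * (c * Y - s * X)); last by ring.
  by rewrite cs Ha; ring.
have rr t : r * t / r ^+ 2 = t * r^-1 by field.
by rewrite !rr rV; split; [rewrite {2}hX|rewrite {2}hY]; ring.
Qed.

(** The velocities are read in Cartesian coordinates, where the radial and angular
    equations of a vortex recombine by [polar_frame]. *)
Lemma reduced_equilibrium z :
  1 + N%:R * eps z != 0 -> (forall i, rad z i != 0) ->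
  injective (configuration z) ->
  (forall i, radial z i = 0) -> (forall i, angular z i = 0) ->
  relative_equilibrium (eps z) (configuration z).
Proof.
move=> k0 r0 inj Hr Ha.
have H j := polar_frame (cos2Dsin2 (ang z j)) (r0 j) (Hr j) (Ha j).
have Hx j : xrel z j / rad z j ^+ 2 + eps z * drift z (xrel z) j = xrel z j.
  by have [] := H j.
have Hy j : yrel z j / rad z j ^+ 2 + eps z * drift z (yrel z) j = yrel z j.
  by have [] := H j.
have rxy j : xrel z j ^+ 2 + yrel z j ^+ 2 = rad z j ^+ 2.
  by rewrite /xrel /yrel !exprMn -mulrDr cos2Dsin2 mulr1.
split=> //.
  rewrite configuration0 (eq_bigr _ (fun i _ => configuration_lift z i)).
  apply: injective_projections;
    rewrite /= ?fst_sum ?snd_sum/= sumrB sumr_const card_ord.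
    by rewrite /GRing.scale/= /kappa -mulr_natl; field.
  by rewrite /GRing.scale/= /kappa -mulr_natl; field.
move=> j; rewrite /velocity perp_sum; congr perp.
have sq0 i : enorm (configuration z ord0 - configuration z (lift ord0 i)) ^+ 2
    = rad z i ^+ 2.
  by rewrite enorm_sqr configuration0 configuration_lift/= -rxy; ring.
have sqr0 i : enorm (configuration z (lift ord0 i) - configuration z ord0) ^+ 2
    = rad z i ^+ 2.
  by rewrite enorm_sqr configuration0 configuration_lift/= -rxy; ring.
have sql i k : enorm (configuration z (lift ord0 k) -
    configuration z (lift ord0 i)) ^+ 2 = sqdist z i k.
  by rewrite enorm_sqr !configuration_lift/= /sqdist; ring.
apply: injective_projections; rewrite ?fst_sum ?snd_sum/=.
  by apply: (@equilibrium_coordinate z _ (fun i : 'I_N.+1 => (configuration z i).1)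
    (fun j i : 'I_N.+1 => enorm (configuration z j - configuration z i) ^+ 2)
    j k0 Hx _ _ sq0 sqr0 sql) => [|i];
    rewrite ?configuration0 ?configuration_lift.
by apply: (@equilibrium_coordinate z _ (fun i : 'I_N.+1 => (configuration z i).2)
    (fun j i : 'I_N.+1 => enorm (configuration z j - configuration z i) ^+ 2)
    j k0 Hy _ _ sq0 sqr0 sql) => [|i];
  rewrite ?configuration0 ?configuration_lift.
Qed.

End ReducedSystem.

(** * Limits of relative equilibria *)

Section CosineOne.
Context {R : realType}.

Lemma cos_eq1 (x : R) : cos x = 1 -> exists k : int, x = k%:~R * (2 * pi).
Proof.
have pi2 : 0 < 2 * pi :> R by rewrite mulr_gt0 ?pi_gt0.
move=> cx; pose k := Num.floor (x / (2 * pi)); exists k.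
pose y := x - k%:~R * (2 * pi).
have /andP[y0 y2] : 0 <= y < 2 * pi.
  rewrite subr_ge0 -ler_pdivlMr// floor_le/= ltrBlDl -[X in _ + X]mul1r -mulrDl.
  by rewrite -ltr_pdivrMr// -intrD1 floorD1_gt.
have cy : cos y = 1.
  have per n a : cos (a + n%:R * (2 * pi)) = cos a :> R.
    by rewrite mulr_natl -(periodicn (@cosD2pi R) n a) -[pi *+ 2]mulr_natl.
  rewrite -cx /y; case: (k) => n; first by rewrite -[LHS](per n) subrK.
  by rewrite NegzE mulrNz mulNr opprK per.
apply/eqP; rewrite -subr_eq0 -/y; apply/negPn/negP => yn0.
have s0 : 0 < sin (y / 2).
  apply: sin_gt0_pi; rewrite ltr_pdivrMr// [pi * 2]mulrC y2 andbT.
  by rewrite divr_gt0// lt0r yn0.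
have : cos y = 1 - 2 * sin (y / 2) ^+ 2.
  by rewrite [in LHS](splitr y) cosD -!expr2 cos2sin2; ring.
have : 0 < sin (y / 2) ^+ 2 by rewrite exprn_gt0.
by rewrite cy; lra.
Qed.

Lemma potential_domain_cos N (theta : 'rV[R]_N) (i j : 'I_N) :
  potential_domain theta -> i != j -> cos (theta 0 i - theta 0 j) != 1.
Proof.
by move=> dom ij; apply/eqP => /cos_eq1[k tij]; have /eqP := dom i j ij k.
Qed.

End CosineOne.

Section Separation.
Context {R : realType}.

Lemma injective_separated n (q : 'I_n -> R * R) : injective q ->
  exists2 m : R, 0 < m & forall i j, i != j -> m <= `|q i - q j|.
Proof.
move=> inj; pose m := \big[Num.min/1]_(ij : 'I_n * 'I_n | ij.1 != ij.2)
  `|q ij.1 - q ij.2|.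
exists m; last by move=> i j ij; exact: (@bigmin_le_cond _ _ _ _ (i, j)).
apply: lt_bigmin => // -[i j]/= ij; rewrite normr_gt0 subr_eq0.
by apply: contra ij => /eqP/inj ->.
Qed.

Lemma prod_norm_leP (u : R * R) (c : R) :
  (`|u| <= c) = (`|u.1| <= c) && (`|u.2| <= c).
Proof. by rewrite [`|u|]/Num.Def.normr/= ge_max. Qed.

Lemma norm_le_enorm (u : R * R) : `|u| <= enorm u.
Proof.
by rewrite prod_norm_leP /enorm -!sqrtr_sqr !ler_wsqrtr ?lerDl ?lerDr ?sqr_ge0.
Qed.

Lemma enorm_le_norm (u : R * R) : enorm u <= 2 * `|u|.
Proof.
have /andP[u1 u2] : (`|u.1| <= `|u|) && (`|u.2| <= `|u|).
  by rewrite -prod_norm_leP.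
rewrite /enorm -[leRHS]ger0_norm ?mulr_ge0// -sqrtr_sqr ler_wsqrtr//.
rewrite -(real_normK (num_real u.1)) -(real_normK (num_real u.2)).
have := normr_ge0 u.1; have := normr_ge0 u.2; nra.
Qed.

(** If the vortices of [q] are distinct, relative equilibria close enough to [q]
    satisfy the uniform bounds on distances and positions by themselves. *)
Lemma relative_equilibrium_limit N (q : 'I_N.+1 -> R * R) : injective q ->
  (forall d : R, 0 < d -> exists (e : R) (q' : 'I_N.+1 -> R * R),
     [/\ e != 0, `|e| < d, relative_equilibrium e q' &
         forall j, `|q j - q' j| <= d]) ->
  relative_equilibrium_1N q.
Proof.
move=> inj H; have [m m0 mq] := injective_separated inj.
have m4 : 0 < m / 4 by rewrite divr_gt0.
have dk (k : nat) : 0 < Num.min (m / 4) k.+1%:R^-1.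
  by rewrite lt_min m4 invr_gt0 ltr0n.
have /choice[e /choice[q_ He]] := fun k => H _ (dk k).
have lim0 : (k.+1%:R^-1 : R) @[k --> \oo] --> 0 by exact: cvg_harmonic.
exists e, q_; split.
- split=> [k|]; first by have [] := He k.
  apply/cvgrPdist_lt => d d0; near=> k.
  have [_ + _ _] := He k; rewrite lt_min sub0r normrN => /andP[_ /lt_trans]; apply.
  near: k; move/cvgrPdist_lt: lim0 => /(_ _ d0); apply: filterS => k.
  by rewrite sub0r normrN ger0_norm.
- by move=> k; have [] := He k.
- move=> j; apply/cvgrPdist_lt => d d0; near=> k.
  have [_ _ _ /(_ j)] := He k; rewrite le_min => /andP[_ /le_lt_trans]; apply.
  near: k; move/cvgrPdist_lt: lim0 => /(_ _ d0); apply: filterS => k.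
  by rewrite sub0r normrN ger0_norm.
exists (m / 2), (2 * (\sum_j `|q j| + m)); split.
- by rewrite divr_gt0.
- by rewrite mulr_gt0// ltr_wpDl// sumr_ge0.
- move=> k i j ij; apply: le_trans (norm_le_enorm _).
  have [_ _ _ qk] := He k.
  have qi : `|q i - q_ k i| <= m / 4.
    by rewrite (le_trans (qk i))// ge_min lexx.
  have qj : `|q_ k j - q j| <= m / 4.
    by rewrite distrC (le_trans (qk j))// ge_min lexx.
  have := mq i j ij.
  have : `|q i - q j| <= `|q i - q_ k i| + `|q_ k i - q_ k j| + `|q_ k j - q j|.
    rewrite (_ : q i - q j =
      (q i - q_ k i) + (q_ k i - q_ k j) + (q_ k j - q j)).
      by rewrite (le_trans (ler_normD _ _))// lerD2r ler_normD.
    by rewrite !addrA !subrK.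
  lra.
move=> k j; rewrite (le_trans (enorm_le_norm _))// ler_pM2l//.
have [_ _ _ /(_ j) qk] := He k.
rewrite -(subrK (q j) (q_ k j)) (le_trans (ler_normD _ _))// addrC lerD//.
  by rewrite (bigD1 j)//= lerDl sumr_ge0.
rewrite distrC (le_trans qk)// ge_min ler_pdivrMr// ler_peMr ?(ltW m0)//.
by rewrite ler1n.
Unshelve. all: by end_near. Qed.

End Separation.

(** * The equations on the unit circle *)

Section Kernel.
Context {R : realType}.

(** The hypothesis concerns the column kernel of [H] and the conclusion its row
    kernel: both have the same dimension, the matrix being square. *)
Lemma kernel_line N (H : 'M[R]_N) (u v : 'rV[R]_N) :
  \rank (kermx H^T) = 1%N -> u != 0 -> u *m H = 0 -> v *m H = 0 ->
  exists c, v = c *: u.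
Proof.
rewrite !mxrank_ker mxrank_tr => rH u0 /sub_kermxP uH /sub_kermxP vH.
apply/sub_rVP; apply: submx_trans vH _.
have := mxrank_leqif_sup uH; rewrite rank_rV u0 mxrank_ker rH.
by case=> _; rewrite eqxx.
Qed.

End Kernel.

Section Derivatives.
Context {R : realType} {N : nat}.
Implicit Types (i j k : 'I_N) (t b phi : 'rV[R]_N).

(** On the unit circle and for zero circulation, [angular] is minus the gradient
    of the potential, compare [partial_potential]. The term - 1 in [pair_force]
    comes from the displacement of the strong vortex. *)
Lemma angular1E t j :
  angular (chart (const_mx 1) t 0) j =
    \sum_(i < N | i != j) pair_force (t 0 j - t 0 i).
Proof.
set z := chart _ _ _.
have xE i : xrel z i = cos (t 0 i).
  by rewrite /xrel rad_chart ang_chart mxE mul1r.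
have yE i : yrel z i = sin (t 0 i).
  by rewrite /yrel rad_chart ang_chart mxE mul1r.
have kE : kappa z = 1.
  by rewrite /kappa eps_chart mulr0 addr0 invr1.
have DE i : sqdist z i j = 2 - 2 * cos (t 0 j - t 0 i).
  by rewrite sqdistC sqdist_chart1.
rewrite /angular /drift kE !mul1r ang_chart.
have sD (c : 'I_N -> R) : \sum_i c i = c j + \sum_(i | i != j) c i.
  by rewrite (bigD1 j).
rewrite (sD (xrel z)) (sD (yrel z)).
have -> : \sum_(i | i != j) pair_force (t 0 j - t 0 i) =
    \sum_(i | i != j)
      (cos (t 0 j) * ((yrel z j - yrel z i) / sqdist z i j)
         + cos (t 0 j) * yrel z i
       - (sin (t 0 j) * ((xrel z j - xrel z i) / sqdist z i j)
         + sin (t 0 j) * xrel z i)).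
  apply: eq_bigr => i _; rewrite DE !xE !yE /pair_force sinB; ring.
by rewrite sumrB !big_split/= -!mulr_sumr xE yE; ring.
Qed.

Lemma is_derive_chart (f : 'rV[R]_(N + N + 1) -> R) r phi e b (l : R) :
  is_derive (chart r phi e) (chart 0 b 0) f l ->
  is_derive phi b (fun t => f (chart r t e)) l.
Proof.
have E h : chart r (h *: b + phi) e = h *: chart 0 b 0 + chart r phi e.
  rewrite /chart !scale_row_mx !add_row_mx scaler0 add0r.
  by congr row_mx; apply/rowP => i; rewrite !mxE mulr0 add0r.
have Eq : (fun h : R =>
      h^-1 *: (f (chart r (h *: b + phi) e) - f (chart r phi e))) =
    (fun h : R =>
      h^-1 *: (f (h *: chart 0 b 0 + chart r phi e) - f (chart r phi e))).
  by apply/funext => h; rewrite E.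
case=> df <-; split; first by rewrite /derivable/= Eq.
by rewrite /derive/= Eq.
Qed.

Section AtCriticalPoint.
Context (phi : 'rV[R]_N)
  (dom : forall i j, i != j -> cos (phi 0 i - phi 0 j) != 1).

Let p := chart (const_mx 1) phi 0.

Lemma strictly_differentiable_coord m (z : 'rV[R]_m) (k : 'I_m) :
  strictly_differentiable (fun z : 'rV[R]_m => z 0 k) z.
Proof. by eexists; exact: strict_derivative_coord. Qed.

Lemma strictly_differentiable_xrel i :
  strictly_differentiable (fun z => xrel z i) p.
Proof.
apply: strictly_differentiableM; first exact: strictly_differentiable_coord.
by apply: strictly_differentiable_cos; exact: strictly_differentiable_coord.
Qed.

Lemma strictly_differentiable_yrel i :
  strictly_differentiable (fun z => yrel z i) p.
Proof.
apply: strictly_differentiableM; first exact: strictly_differentiable_coord.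
by apply: strictly_differentiable_sin; exact: strictly_differentiable_coord.
Qed.

Lemma sqdist_neq0 i j : i != j -> sqdist p i j != 0.
Proof.
move=> ij; rewrite sqdist_chart1 lt0r_neq0//.
exact/two_minus_2cos_gt0/dom.
Qed.

Lemma strictly_differentiable_sqdist i j :
  strictly_differentiable (fun z => sqdist z i j) p.
Proof.
by apply: strictly_differentiableD; apply: strictly_differentiableM;
  apply: strictly_differentiableB;
  do [exact: strictly_differentiable_xrel | exact: strictly_differentiable_yrel].
Qed.

Lemma strictly_differentiable_kappa : strictly_differentiable (@kappa R N) p.
Proof.
apply: strictly_differentiableV.
  by rewrite eps_chart mulr0 addr0 oner_neq0.
apply: strictly_differentiableD; first exact: strictly_differentiable_cst.
by apply: strictly_differentiableM;
  [exact: strictly_differentiable_cst|exact: strictly_differentiable_coord].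
Qed.

Lemma strictly_differentiable_drift (c : 'rV[R]_(N + N + 1) -> 'I_N -> R) j :
  (forall i, strictly_differentiable (fun z => c z i) p) ->
  strictly_differentiable (fun z => drift z (c z) j) p.
Proof.
move=> sc; apply: strictly_differentiableD.
  apply: strictly_differentiable_sum => i ij.
  apply: strictly_differentiableM; first exact: strictly_differentiableB.
  apply: strictly_differentiableV; first exact: sqdist_neq0.
  exact: strictly_differentiable_sqdist.
apply: strictly_differentiableM; first exact: strictly_differentiable_kappa.
by apply: strictly_differentiable_sum => i _.
Qed.

Lemma strictly_differentiable_angular j :
  strictly_differentiable (fun z => angular z j) p.
Proof.
apply: strictly_differentiableB; apply: strictly_differentiableM.
- by apply: strictly_differentiable_cos; exact: strictly_differentiable_coord.
- by apply: strictly_differentiable_drift; exact: strictly_differentiable_yrel.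
- by apply: strictly_differentiable_sin; exact: strictly_differentiable_coord.
- by apply: strictly_differentiable_drift; exact: strictly_differentiable_xrel.
Qed.

(** As [eps] vanishes at [p], the derivative of the term with factor [eps z] sees
    [eps] alone: to first order, the radial equations ignore the angles. *)
Lemma strict_derivative_radial j : exists C : R,
  strict_derivative (fun z => radial z j) p
    (fun w => - 2 * rad w j + C * eps w).
Proof.
have [LA sA] : strictly_differentiable (fun z =>
    cos (ang z j) * drift z (xrel z) j + sin (ang z j) * drift z (yrel z) j) p.
  apply: strictly_differentiableD; apply: strictly_differentiableM.
  - by apply: strictly_differentiable_cos; exact: strictly_differentiable_coord.
  - by apply: strictly_differentiable_drift; exact: strictly_differentiable_xrel.
  - by apply: strictly_differentiable_sin; exact: strictly_differentiable_coord.
  - by apply: strictly_differentiable_drift; exact: strictly_differentiable_yrel.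
have sr : strict_derivative (fun z => rad z j) p (fun w => rad w j).
  exact: strict_derivative_coord.
have se : strict_derivative (@eps R N) p (@eps R N).
  exact: strict_derivative_coord.
have r1 : rad p j = 1 by rewrite rad_chart mxE.
have r0 : rad p j != 0 by rewrite r1 oner_neq0.
eexists; apply: strict_derivative_eq (strict_derivativeD
  (strict_derivativeB (strict_derivativeV r0 sr) sr) (strict_derivativeM se sA))
  => // w.
rewrite r1 eps_chart expr1n invr1 mul0r addr0; congr (_ + _ * _); ring.
Qed.

End AtCriticalPoint.
End Derivatives.

(** * Continuation from a nondegenerate critical point *)

Section Nondegenerate.
Context {R : realType} {N : nat}.
Context (phi : 'rV[R]_N) (N0 : (0 < N)%N)
  (nd : nondegenerate_critical_point phi).
Implicit Types (i j : 'I_N) (t b : 'rV[R]_N).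

Let H := hessian (@potential R N) phi.
Let p := chart (const_mx 1) phi 0.

Lemma nd_cos_neq1 i j : i != j -> cos (phi 0 i - phi 0 j) != 1.
Proof. by move: nd => [[dom _] _] ij; exact: potential_domain_cos. Qed.

Lemma near_cos_neq1 : \forall t \near phi, forall i j,
  i != j -> cos ((t : 'rV[R]_N) 0 i - t 0 j) != 1.
Proof.
have : \forall t \near phi, forall ij : 'I_N * 'I_N,
    ij.1 != ij.2 -> cos ((t : 'rV[R]_N) 0 ij.1 - t 0 ij.2) != 1.
  apply: (@filter_forall _ _ (fun ij (t : 'rV[R]_N) =>
    ij.1 != ij.2 -> cos (t 0 ij.1 - t 0 ij.2) != 1) (nbhs phi) _) => -[i j]/=.
  have [ij|ij] := eqVneq i j; first by near=> t.
  have : {for phi, continuous (fun t : 'rV[R]_N => cos (t 0 i - t 0 j))}.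
    apply: strictly_differentiable_continuous; apply: strictly_differentiable_cos.
    by apply: strictly_differentiableB; exact: strictly_differentiable_coord.
  move=> /(_ [set x | x != 1])/= cphi.
  have /cphi nb : nbhs (cos (phi 0 i - phi 0 j)) [set x | x != 1].
    by apply: open_nbhs_nbhs; split; [exact: open_neq|exact: nd_cos_neq1].
  by near=> t => _; near: t; exact: nb.
apply: filterS => t tP i j; exact: (tP (i, j)).
Unshelve. all: by end_near. Qed.

Lemma is_derive_angular1 LA j b :
  strict_derivative (fun z => angular z j) p LA ->
  is_derive phi b (fun t => angular (chart (const_mx 1) t 0) j)
    (LA (chart 0 b 0)).
Proof.
move=> sA; apply: (@is_derive_chart R N (fun z => angular z j)).
exact: strict_derivative_is_derive.
Qed.

(** Near [phi], [angular] on the unit circle is minus the gradient of the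
    potential, so its derivative at [phi] is minus the Hessian. *)
Lemma angular_hessian LA j b : strict_derivative (fun z => angular z j) p LA ->
  LA (chart 0 b 0) = - (b *m H) 0 j.
Proof.
move=> sA.
have E i : LA (chart 0 (delta_mx 0 i) 0) = - H i j.
  rewrite mxE {1}/partial.
  rewrite (@near_eq_derive _ _ _ _
     (fun t => - angular (chart (const_mx 1) t 0) j)); last first.
    by apply: filterS near_cos_neq1 => t tP; rewrite partial_potential// angular1E.
  have dA := is_derive_angular1 (delta_mx 0 i) sA.
  by rewrite (@derive_val _ _ _ _ _ _ _ (is_deriveN dA)) opprK.
have [lA _ _] := sA; have L0 := strict_derivative0 sA.
rewrite {1}(row_sum_delta b) mxE -sumrN /chart.
have -> : const_mx 0 = 0 :> 'rV[R]_1 by apply/rowP => i; rewrite !mxE.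
elim/big_rec2 : _ => [|i y w _ IH]; first by rewrite !row_mx0 L0.
rewrite -mulrN -E -IH -lA /chart.
have -> : const_mx 0 = 0 :> 'rV[R]_1 by apply/rowP => k; rewrite !mxE.
by rewrite !scale_row_mx !add_row_mx !scaler0 !addr0.
Qed.

(** Rotating all the vortices together changes no difference of angles. *)
Lemma hessian_rotation : (const_mx 1 : 'rV[R]_N) *m H = 0.
Proof.
apply/rowP => j; rewrite [RHS]mxE.
have [LA sA] := strictly_differentiable_angular nd_cos_neq1 j.
apply: oppr_inj; rewrite -(angular_hessian _ sA) oppr0.
have [_ <-] := is_derive_angular1 (const_mx 1) sA.
apply: derive_invariant => h; rewrite !angular1E; apply: eq_bigr => i _.
by rewrite !mxE; congr pair_force; ring.
Qed.

(** Differentiating the torque balance on the unit circle. *)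
Lemma hessian_torque b : \sum_j (b *m H) 0 j = 0.
Proof.
have /choice[LA sA] := strictly_differentiable_angular nd_cos_neq1.
have dj j := is_derive_angular1 b (sA j).
have := is_derive_sum dj.
have -> : \sum_(j < N) (fun t => angular (chart (const_mx 1) t 0) j) = cst 0.
  apply/funext => t; rewrite fct_sumE/=.
  rewrite -[RHS](torque_balance (chart (const_mx 1) t 0)).
  by apply: eq_bigr => j _; rewrite rad_chart mxE mul1r.
case=> _; rewrite derive_cst => /esym L0.
rewrite -[RHS]oppr0 -[in RHS]L0 -sumrN.
by apply: eq_bigr => j _; rewrite (angular_hessian _ (sA j)) opprK.
Qed.

(** The total displacement of the angles is added to every angular equation in
    order to break the rotation invariance; [equation_equilibrium] shows that it
    vanishes at every solution. *)
Definition equation (k : 'I_(N + N)) (z : 'rV[R]_(N + N + 1)) : R :=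
  match fintype.split k with
  | inl j => radial z j
  | inr j => angular z j + \sum_i (ang z i - phi 0 i)
  end.

Lemma equation_critical k : equation k p = 0.
Proof.
rewrite /equation; case: fintype.split => j.
  by rewrite /radial rad_chart mxE eps_chart invr1 subrr mul0r addr0.
have -> : \sum_i (ang p i - phi 0 i) = 0.
  by apply: big1 => i _; rewrite ang_chart subrr.
rewrite addr0 angular1E.
apply: oppr_inj; rewrite oppr0 -(partial_potential j nd_cos_neq1).
by move: nd => [[_ ->]].
Qed.

(** The radial rows give [lsubmx v = 0]. Adding up the angular rows isolates the
    sum of the entries of [b = rsubmx v], by [hessian_torque]; once it is zero,
    [b] is in the kernel of the Hessian, hence constant, hence zero. *)
Lemma equation_jacobian : exists2 L : 'I_(N + N) -> 'rV[R]_(N + N + 1) -> R,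
  (forall k, strict_derivative (equation k) p (L k)) &
  (forall v : 'rV_(N + N), (forall k, L k (row_mx v 0) = 0) -> v = 0).
Proof.
have /choice[LA sA] := strictly_differentiable_angular nd_cos_neq1.
have /choice[C sR] := strict_derivative_radial nd_cos_neq1.
exists (fun k => match fintype.split k with
  | inl j => fun w => - 2 * rad w j + C j * eps w
  | inr j => fun w => LA j w + \sum_i (ang w i - 0)
  end).
  move=> k; rewrite /equation; case: fintype.split => j; first exact: sR.
  apply: strict_derivativeD; first exact: sA.
  apply: strict_derivative_sum => i _; apply: strict_derivativeB.
    exact: strict_derivative_coord.
  exact: strict_derivative_cst.
move=> v Lv; rewrite -(hsubmxK v).
have a0 : lsubmx v = 0.
  apply/rowP => j; have := Lv (lshift N j).
  rewrite (unsplitK (inl j)) /rad /eps row_mxEl row_mxEr [(0 : 'rV_1) _ _]mxE !mxE.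
  lra.
set b := rsubmx v.
have wE : row_mx v 0 = chart 0 b 0.
  rewrite /chart -[v]hsubmxK a0; congr row_mx; by apply/rowP => i; rewrite !mxE.
have Lb j : - (b *m H) 0 j + \sum_i b 0 i = 0.
  rewrite -(angular_hessian _ (sA j)) -wE -[RHS](Lv (rshift N j)).
  rewrite (unsplitK (inr j)); congr (_ + _); apply: eq_bigr => i _.
  by rewrite wE ang_chart subr0.
have Sb : \sum_i b 0 i = 0.
  have : \sum_j (- (b *m H) 0 j + \sum_i b 0 i) = 0 by apply: big1 => j _.
  rewrite big_split/= sumrN hessian_torque oppr0 add0r sumr_const card_ord.
  by move/eqP; rewrite mulrn_eq0 eqn0Ngt N0 => /eqP.
have bH : b *m H = 0.
  apply/rowP => j; have /eqP := Lb j.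
  by rewrite Sb addr0 oppr_eq0 => /eqP ->; rewrite mxE.
have u0 : const_mx 1 != 0 :> 'rV[R]_N.
  by apply/eqP => /rowP /(_ (Ordinal N0)) /eqP; rewrite !mxE oner_eq0.
have [c bE] := kernel_line nd.2 u0 hessian_rotation bH.
have c0 : c = 0.
  move: Sb; rewrite bE; under eq_bigr do rewrite !mxE mulr1.
  by rewrite sumr_const card_ord => /eqP; rewrite mulrn_eq0 eqn0Ngt N0 => /eqP.
by rewrite a0 bE c0 scale0r row_mx0.
Qed.

(** Stated for an arbitrary neighbourhood [P], so that all the smallness
    conditions on the solution can be requested at once. *)
Lemma near_solution (P : set 'rV[R]_(N + N + 1)) : (\forall z \near p, P z) ->
  exists z, [/\ P z, eps z != 0 & forall k, equation k z = 0].
Proof.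
move=> /nbhs_ballP[r /= r0 rP].
have [L sL injL] := equation_jacobian.
have r2 : 0 < r / 2 by rewrite divr_gt0.
have [e0 e00 sol] := implicit_solution sL equation_critical injL r2.
pose e := Num.min (e0 / 2) (r / 2).
have ep : 0 < e by rewrite lt_min r2 divr_gt0.
have /sol[x xp xE] : `|e| < e0.
  by rewrite gtr0_norm// gt_min ltr_pdivrMr// mulr_natr mulr2n ltrDl e00.
exists (row_mx x (const_mx e)); split=> //; last first.
  by rewrite /eps row_mxEr mxE lt0r_neq0.
apply: rP; rewrite -ball_normE /=.
rewrite (_ : p - _ =
  row_mx (row_mx (const_mx 1) phi - x) (const_mx (- e))); last first.
  rewrite /p /chart opp_row_mx add_row_mx; congr row_mx.
  by apply/rowP => j; rewrite !mxE sub0r.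
apply: (@le_lt_trans _ _ (r / 2)); last first.
  by rewrite ltr_pdivrMr// mulr_natr mulr2n ltrDl.
rewrite row_mx_norm_le//; apply: mx_norm_le => [|i j]; first exact: ltW.
by rewrite mxE normrN gtr0_norm// ge_min lexx orbT.
Qed.

(** In the torque balance the common term is multiplied by the sum of the radii,
    which is positive, so this term is zero. *)
Lemma equation_equilibrium z : (forall i, 0 < rad z i) -> 1 + N%:R * eps z != 0 ->
  injective (configuration z) -> (forall k, equation k z = 0) ->
  relative_equilibrium (eps z) (configuration z).
Proof.
move=> r0 k0 inj Ez.
have Er j : radial z j = 0.
  by have := Ez (lshift N j); rewrite /equation (unsplitK (inl j)).
have Ea j : angular z j + \sum_i (ang z i - phi 0 i) = 0.
  by have := Ez (rshift N j); rewrite /equation (unsplitK (inr j)).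
set la := \sum_i (ang z i - phi 0 i) in Ea.
have la0 : la = 0.
  have : \sum_j rad z j * (angular z j + la) = 0.
    by apply: big1 => j _; rewrite Ea mulr0.
  under eq_bigr do rewrite mulrDr.
  rewrite big_split/= torque_balance add0r -mulr_suml => /eqP; rewrite mulf_eq0.
  case/orP => /eqP // S0; exfalso.
  have : 0 < \sum_j rad z j.
    rewrite (bigD1 (Ordinal N0))//= ltr_wpDr// sumr_ge0// => i _; exact: ltW.
  by rewrite S0 ltxx.
apply: reduced_equilibrium => // [i|j]; first by rewrite lt0r_neq0.
by have := Ea j; rewrite la0 addr0.
Qed.

Lemma configuration_critical :
  configuration p = polar_configuration 0 (const_mx 1) phi.
Proof.
apply/funext => j; rewrite /configuration /polar_configuration eps_chart.
have -> : (- (0 * kappa p * \sum_i xrel p i),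
           - (0 * kappa p * \sum_i yrel p i)) = 0 :> R * R.
  by rewrite !mul0r oppr0.
case: (unliftP ord0 j) => [i _|_]; last by rewrite oppr0 scale0r.
by rewrite addr0 /polar /xrel /yrel rad_chart ang_chart.
Qed.

Lemma configuration_critical_inj : injective (configuration p).
Proof.
have q0 : configuration p ord0 = 0.
  by rewrite configuration0 eps_chart !mul0r oppr0.
have ql i : configuration p (lift ord0 i) = (cos (phi 0 i), sin (phi 0 i)).
  rewrite configuration_lift eps_chart !mul0r !subr0 /xrel /yrel.
  by rewrite rad_chart ang_chart mxE !mul1r.
have nz i : (cos (phi 0 i), sin (phi 0 i)) <> 0 :> R * R.
  case=> c s; have /eqP := cos2Dsin2 (phi 0 i).
  by rewrite c s expr0n addr0 eq_sym oner_eq0.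
move=> j k; case: (unliftP ord0 j) => [i ->|->];
  case: (unliftP ord0 k) => [l ->|->] //.
- rewrite !ql => -[c s]; congr lift; apply/eqP/negPn/negP => /nd_cos_neq1/eqP; apply.
  by rewrite cosB c s -!expr2 cos2Dsin2.
- by rewrite q0 ql => /nz.
- by rewrite q0 ql => /esym/nz.
Qed.

Lemma near_configuration (d : R) : 0 < d ->
  \forall z \near p, forall j : 'I_N.+1,
    `|configuration p j - configuration z j| <= d.
Proof.
move=> d0.
apply: (@filter_forall _ _ (fun (j : 'I_N.+1) z =>
  `|configuration p j - configuration z j| <= d) (nbhs p) _) => j.
have near_le (f : 'rV[R]_(N + N + 1) -> R) : strictly_differentiable f p ->
    \forall z \near p, `|f p - f z| <= d.
  by move=> /strictly_differentiable_continuous/cvgrPdist_le; apply.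
have sd_center (c : 'rV[R]_(N + N + 1) -> 'I_N -> R) :
    (forall i, strictly_differentiable (fun z => c z i) p) ->
    strictly_differentiable (fun z => eps z * kappa z * \sum_i c z i) p.
  move=> sc; apply: strictly_differentiableM; last by apply: strictly_differentiable_sum.
  apply: strictly_differentiableM; first exact: strictly_differentiable_coord.
  exact: strictly_differentiable_kappa.
have sx := sd_center _ (strictly_differentiable_xrel phi).
have sy := sd_center _ (strictly_differentiable_yrel phi).
have c0 := strictly_differentiable_cst (0 : R) p.
case: (unliftP ord0 j) => [i ->|->].
  have sxi := strictly_differentiable_xrel phi i.
  have syi := strictly_differentiable_yrel phi i.
  have n1 := near_le _ (strictly_differentiableB sxi sx).
  have n2 := near_le _ (strictly_differentiableB syi sy).
  near=> z; rewrite !configuration_lift prod_norm_leP.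
  by apply/andP; split; near: z.
have n1 := near_le _ (strictly_differentiableB c0 sx).
have n2 := near_le _ (strictly_differentiableB c0 sy).
have c0E z : configuration z ord0 = (0 - eps z * kappa z * \sum_i xrel z i,
                                     0 - eps z * kappa z * \sum_i yrel z i).
  by rewrite configuration0 !sub0r.
by near=> z; rewrite !c0E prod_norm_leP; apply/andP; split; near: z.
Unshelve. all: by end_near. Qed.

End Nondegenerate.

Theorem theorem1 (R : realType) (N : nat) (hN : (0 < N)%N) (phi : 'rV[R]_N)
  (hphi : nondegenerate_critical_point phi) :
  relative_equilibrium_1N (polar_configuration 0 (const_mx 1) phi).
Proof.
have inj := configuration_critical_inj hphi.
rewrite -configuration_critical; apply: relative_equilibrium_limit => // d d0.
have [m m0 mP] := injective_separated inj.
set p := chart (const_mx 1) phi 0 in inj mP *.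
(* Vortices of p are at distance at least m; moving each by at most m / 4 keeps
   them apart. *)
have d' : 0 < Num.min d (m / 4) by rewrite lt_min d0 divr_gt0.
have nc := near_configuration phi d'.
have cvg_coord k : {for p, continuous (fun z : 'rV[R]_(N + N + 1) => z 0 k)}.
  exact: strictly_differentiable_continuous (strictly_differentiable_coord _ _).
have nr : \forall z \near p, forall i, 0 < rad z i.
  apply: (@filter_forall _ _ (fun i z => 0 < rad z i) (nbhs p) _) => i.
  apply: (cvg_coord (lshift 1 (lshift N i)) [set x : R | 0 < x]); apply: open_nbhs_nbhs.
  by split; [exact: open_gt|rewrite /= -/(rad p i) rad_chart mxE].
(* The bound (2 N)^-1 keeps 1 + N * eps z, the denominator of kappa, nonzero. *)
have ne : \forall z \near p, `|eps z| < Num.min d (2 * N%:R)^-1.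
  have /cvgrPdist_lt/(_ (Num.min d (2 * N%:R)^-1)) :=
    cvg_coord (rshift (N + N) 0).
  rewrite lt_min d0 invr_gt0 mulr_gt0// ?ltr0n// => /(_ isT); apply: filterS => z.
  by rewrite -/(eps p) eps_chart sub0r normrN.
have [z [[Pc [Pr Pe]] e0 Ez]] :=
  near_solution hN hphi (filterI nc (filterI nr ne)).
have Pd j : `|configuration p j - configuration z j| <= d.
  by rewrite (le_trans (Pc j))// ge_min lexx.
have Pm j : `|configuration p j - configuration z j| <= m / 4.
  by rewrite (le_trans (Pc j))// ge_min lexx orbT.
move: Pe; rewrite lt_min => /andP[Pe eN].
exists (eps z), (configuration z); split=> //.
apply: (equation_equilibrium hN _ _ _ Ez) => //.
  have Ne : `|N%:R * eps z| < 1.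
    rewrite normrM normr_nat -ltr_pdivlMl ?ltr0n// mulr1 (lt_trans eN)//.
    by rewrite invfM gtr_pMl ?invr_gt0 ?ltr0n// invf_lt1// ltr1n.
  by move: Ne; rewrite ltr_norml => /andP[Ne _]; rewrite lt0r_neq0//; lra.
move=> i j ij; apply/eqP/negPn/negP => /mP.
rewrite -(subrK (configuration z j) (configuration p i)) -addrA -{1}ij.
rewrite leNgt => /negP; apply; apply: (@le_lt_trans _ _ (m / 4 + m / 4)); last by lra.
by rewrite (le_trans (ler_normD _ _))// lerD// distrC.
Qed.
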